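(* Let $k, n, r, s$ be positive integers such that $r \cdot s \leq 2^{n-1}$ and $k \cdot 2^s + 1 \mid k^{2r} + 2^{2^n - 2rs}$. Then $k \cdot 2^s + 1 \mid F_n$.
   Context: $F_n = 2^{2^n} + 1$ denotes the $n$-th Fermat number, for every $n \in \mathbb{N} = \{0,1,2,\dots\}$. *)

(* Defs.v *)
From mathcomp Require Import all_boot.

Definition fermat (n : nat) : nat := 2 ^ (2 ^ n) + 1.

(* Main.v *)
(** Put [x = k * 2 ^ s]. Modulo [x + 1] we have [x ^ 2 = 1], so multiplying the
    hypothesis by [2 ^ (2 * r * s)] turns its left summand into
    [x ^ (2 * r) = 1] and its right summand into [2 ^ (2 ^ n)]. *)
Require Import Defs.
From mathcomp Require Import all_boot.

(** Here [x] is congruent to -1, so every even power of it is 1. *)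
Lemma expn_double_mod_succ (x r : nat) : x ^ (2 * r) = 1 %[mod x + 1].
Proof.
have x2 : x ^ 2 = 1 %[mod x + 1].
  (* [x ^ 2 = (x - 1) * (x + 1) + 1] fails at 0 under truncated subtraction; there the modulus is
     1. *)
  case: x => [|x]; first by rewrite !modn1.
  have -> : x.+1 ^ 2 = x * (x.+1 + 1) + 1.
    by rewrite -mulnn mulSn !addn1 [x * _.+2]mulnS addSn.
  by rewrite modnMDl.
by rewrite expnM -modnXm x2 modnXm exp1n.
Qed.

Theorem theorem2p8 (k n r s : nat)
    (k_gt0 : 0 < k) (n_gt0 : 0 < n) (r_gt0 : 0 < r) (s_gt0 : 0 < s)
    (le_rs : r * s <= 2 ^ (n - 1))
    (dvd_sum : k * 2 ^ s + 1 %| k ^ (2 * r) + 2 ^ (2 ^ n - 2 * r * s)) :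
  k * 2 ^ s + 1 %| fermat n.
Proof.
(* Ensures that the subtraction in the exponent of [dvd_sum] is not truncated. *)
have le_2rs : 2 * r * s <= 2 ^ n.
  by rewrite -(subnK n_gt0) addn1 expnS -mulnA leq_mul2l.
have -> : fermat n = 2 ^ (2 ^ n) + 1 by [].
(* The summand 1 of the Fermat number becomes [(k * 2 ^ s) ^ (2 * r)]; then [2 ^ (2 * r * s)]
   factors out and leaves the sum in [dvd_sum]. *)
rewrite /dvdn addnC -modnDml -(expn_double_mod_succ _ r) modnDml.
rewrite expnMn -expnM -[X in _ + 2 ^ X](subnK le_2rs) expnD.
by rewrite (mulnC s) -mulnDl -/(dvdn _ _) dvdn_mulr.
Qed.
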